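(* Let $X$ be a real Banach space and let $\tau$ denote either the norm topology or the weak topology on $X$. Let $Y$ be a finite dimensional subspace of $X$ and let $Z$ be a closed linear subspace of $X$ such that $(X,Z,\mathcal{F}(X))$ has $\tau$-$\mathscr{F}_{cmc}$-SACP. Then $(X,Y+Z,\mathcal{F}(X))$ has $\tau$-$\mathscr{F}_{cmc}$-SACP.
   Context: All Banach spaces are real. $\mathcal{F}(X)$ is the set of all nonempty finite subsets of $X$. $\mathscr{F}_{cmc}$ is the class of all functions $f:\mathbb{R}^N_+\to\mathbb{R}_+$, $N\in\mathbb{N}$, that are convex, monotone ($\varphi_1\le\varphi_2$ coordinatewise implies $f(\varphi_1)\le f(\varphi_2)$) and coercive ($f(\varphi)\to\infty$ as $\|\varphi\|_\infty\to\infty$). For $x\in X$, a $\tau$-closed subset $V\subseteq X$, $F=\{x_1,\dots,x_N\}\in\mathcal{F}(X)$ and $f:\mathbb{R}^N_+\to\mathbb{R}_+$: $r_f(x,F)=f(\|x-x_1\|,\dots,\|x-x_N\|)$ and $\mathrm{rad}_V^f(F)=\inf_{v\in V}r_f(v,F)$. The triplet $(X,V,\mathcal{F}(X))$ has $\tau$-$\mathscr{F}_{cmc}$-SACP ($\mathscr{F}_{cmc}$-simultaneous approximative $\tau$-compactness property) if for every $F=\{x_1,\dots,x_N\}\in\mathcal{F}(X)$ and every $f:\mathbb{R}^N_+\to\mathbb{R}_+$ in $\mathscr{F}_{cmc}$, every sequence $(v_n)\subseteq V$ with $r_f(v_n,F)\to\mathrm{rad}_V^f(F)$ has a $\tau$-convergent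 subsequence. *)

(* Defs.v *)
From HB Require Import structures.
From mathcomp Require Import all_boot all_order all_algebra.
From mathcomp Require Import all_classical all_reals all_analysis.

Set Implicit Arguments.
Unset Strict Implicit.
Unset Printing Implicit Defensive.

Import Order.TTheory GRing.Theory Num.Theory.
Import numFieldNormedType.Exports.

Local Open Scope classical_set_scope.
Local Open Scope ring_scope.

Section topologies.
Context {R : realType} (X : normedModType R).

(* A topology on X is a value tau : Topological X, and Topological.Pack tau is
   the resulting topological space, whose carrier is X. *)
Definition norm_topology : Topological X := Topological.class X.

Definition dual := {phi : {linear X -> R^o} | continuous phi}.

(* The coarsest topology making every element of the dual continuous. *)
Definition weak_topology : Topological X :=
  Topological.class (sup_topology (fun phi : dual =>
    Topological.class (initial_topology (sval phi : X -> R^o)))).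

End topologies.

Section topology_notions.
Context {X : Type} (tau : Topological X).

Definition tau_closed (V : set X) : Prop := @closed (Topological.Pack tau) V.

Definition tau_convergent (u : nat -> X) : Prop :=
  exists l : Topological.Pack tau, u @ \oo --> l.

Definition has_tau_convergent_subsequence (u : nat -> X) : Prop :=
  exists2 s : nat -> nat, {homo s : m n / (m < n)%N} & tau_convergent (u \o s).

End topology_notions.

Section subspaces.
Context {R : realType} {X : normedModType R}.

Definition linear_subspace (V : set X) : Prop :=
  GRing.submod_closed (mem V).

Definition finite_dim_subspace (V : set X) : Prop :=
  exists (n : nat) (e : 'I_n -> X),
    V = [set \sum_(i < n) a i *: e i | a in [set: 'I_n -> R]].

Definition set_add (A B : set X) : set X := [set a + b | a in A & b in B].

End subspaces.

Definition nonempty_finite {X : Type} (F : set X) : Prop :=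
  finite_set F /\ F !=set0.

Section convex_monotone_coercive.
Context {R : realType} {N : nat}.

Definition orthant : set 'rV[R]_N := [set phi | forall i, 0 <= phi ord0 i].

(* A function R_+^N -> R_+ is represented by a function on all of R^N that is
   only constrained on the orthant.  The norm of 'rV[R]_N is the sup norm. *)
Record Fcmc (f : 'rV[R]_N -> R) : Prop := {
  Fcmc_ge0 : forall phi, orthant phi -> 0 <= f phi;
  Fcmc_convex :
    convex_function (orthant : set (convex_lmodType 'rV[R]_N)) (f : _ -> R^o);
  Fcmc_monotone : forall phi1 phi2, orthant phi1 -> orthant phi2 ->
    (forall i, phi1 ord0 i <= phi2 ord0 i) -> f phi1 <= f phi2;
  Fcmc_coercive : forall M : R, exists K : R,
    forall phi, orthant phi -> K <= `|phi| -> M <= f phi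
}.

End convex_monotone_coercive.

Section sacp.
Context {R : realType} {X : normedModType R}.

Section radius.
Context {N : nat} (f : 'rV[R]_N -> R).

Definition rf (v : X) (x : 'I_N -> X) : R := f (\row_i `|v - x i|).

Definition rad (V : set X) (x : 'I_N -> X) : R := inf [set rf v x | v in V].

End radius.

(* set_bij [set: 'I_N] F x says that x_1, ..., x_N lists F without repetition;
   rf depends on the listing, so all listings of F are considered. *)
Definition Fcmc_SACP (tau : Topological X) (V : set X) : Prop :=
  tau_closed tau V /\
  forall F : set X, nonempty_finite F ->
  forall (N : nat) (x : 'I_N -> X), set_bij [set: 'I_N] F x ->
  forall f : 'rV[R]_N -> R, Fcmc f ->
  forall v : nat -> X, (forall n, V (v n)) ->
    (rf f (v n) x @[n --> \oo] --> rad f V x) ->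
    has_tau_convergent_subsequence tau v.

End sacp.

(* Main.v *)
(* Adding the generators of Y one at a time reduces the claim to a line R e with
   e outside Z.  By Hahn-Banach some functional phi vanishes on Z and satisfies
   phi e = 1.  The sum R e + Z is then the preimage of Z under the
   tau-continuous map w |-> w - phi(w) e, hence tau-closed.  A minimizing sequence
   w_n = a_n e + z_n is bounded because f is coercive, so a_n = phi(w_n) is
   bounded and converges to some a along a subsequence.  As f is uniformly
   continuous on bounded sets, a e + z_n is still minimizing along it, that is,
   z_n is minimizing in Z for the translates x_i - a e, and the property of Z
   applies. *)
From HB Require Import structures.
Require Import Defs.
From mathcomp Require Import all_boot all_order all_algebra.
From mathcomp Require Import all_classical all_reals all_analysis.
From mathcomp Require Import lra.

Set Implicit Arguments.
Unset Strict Implicit.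
Unset Printing Implicit Defensive.

Import Order.TTheory GRing.Theory Num.Theory.
Import numFieldNormedType.Exports.

Local Open Scope classical_set_scope.
Local Open Scope ring_scope.

(** * Sublinear functionals and the algebraic Hahn-Banach theorem *)

Section sublinear.
Context {R : realType} {X : lmodType R}.
Implicit Types (p q : X -> R) (C : set (X * R)).

(** Using [t^-1] as well turns the scaling inequality into an equality for [t > 0]. *)
Definition sublinear p :=
  (forall x y, p (x + y) <= p x + p y) /\
  (forall (t : R) x, 0 < t -> p (t *: x) <= t * p x).

Lemma sublinear0 p : sublinear p -> p 0 = 0.
Proof.
move=> [pD pZ]; have := pD 0 0; rewrite addr0 => h1.
have := @pZ (1/2) 0; rewrite scaler0 => /(_ ltac:(lra)) h2; lra.
Qed.

Lemma sublinear_oppr p x : sublinear p -> - p (- x) <= p x.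
Proof.
move=> ps; have := ps.1 x (- x); rewrite subrr (sublinear0 ps); lra.
Qed.

(** Each inequality, applied at opposite points, gives its own reverse by oddness. *)
Lemma sublinear_odd_linear p :
  sublinear p -> (forall x, p (- x) <= - p x) -> linear (p : X -> R^o).
Proof.
move=> ps podd; have pN x : p (- x) = - p x.
  apply/eqP; rewrite eq_le podd /=.
  by have := sublinear_oppr (- x) ps; rewrite opprK; lra.
have pZ t x : 0 < t -> p (t *: x) = t * p x.
  move=> t0; apply/eqP; rewrite eq_le ps.2 //=.
  by have := ps.2 t (- x) t0; rewrite scalerN !pN; lra.
move=> t x y; have -> : p (t *: x + y) = p (t *: x) + p y.
  apply/eqP; rewrite eq_le ps.1 /=.
  by have := ps.1 (- (t *: x)) (- y); rewrite -opprD !pN; lra.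
congr (_ + _); change (p (t *: x) = t * p x).
case: (ltgtP t 0) => [t0|/pZ //|->].
  have := @pZ (- t) x; rewrite scaleNr pN => /(_ ltac:(lra)); lra.
by rewrite scale0r mul0r (sublinear0 ps).
Qed.

(* q x is the infimum of p (x + k) - c over (k, c) in C. *)
Lemma sublinear_cone p C : sublinear p -> C (0, 0) ->
  (forall u v, C u -> C v -> C (u.1 + v.1, u.2 + v.2)) ->
  (forall (t : R) u, 0 < t -> C u -> C (t *: u.1, t * u.2)) ->
  (forall u, C u -> u.2 <= p u.1) ->
  exists q, [/\ sublinear q, forall x, q x <= p x &
    forall u, C u -> q (- u.1) <= - u.2].
Proof.
move=> ps C0 CD CZ Cp.
pose S x := [set p (x + u.1) - u.2 | u in C].
have Sn x : S x !=set0 by exists (p (x + 0) - 0); exists (0, 0).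
have Slb x : has_lbound (S x).
  (* The bound is [u.2 <= p u.1 <= p (x + u.1) + p (- x)], rearranged. *)
  exists (- p (- x)) => _ [u Cu <-].
  have := ps.1 (x + u.1) (- x); rewrite addrAC subrr add0r.
  have := Cp _ Cu; lra.
have qle x u : C u -> inf (S x) <= p (x + u.1) - u.2.
  by move=> Cu; apply: ge_inf => //; exists u.
have geS x b : (forall u, C u -> b <= p (x + u.1) - u.2) -> b <= inf (S x).
  by move=> bS; apply: lb_le_inf => // _ [u Cu <-]; exact: bS.
exists (fun x => inf (S x)); split; first split.
- move=> x y.
  (* The infima at [x] and [y] are replaced by arbitrary members one after the other; the sum of the
     two cone elements then serves at [x + y]. *)
  suff : inf (S (x + y)) - inf (S y) <= inf (S x) by lra.
  apply/geS => u Cu.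
  suff : inf (S (x + y)) - (p (x + u.1) - u.2) <= inf (S y) by lra.
  apply/geS => v Cv; have /= := qle (x + y) _ (CD _ _ Cu Cv).
  have := ps.1 (x + u.1) (y + v.1); rewrite addrACA; lra.
- move=> t x t0; rewrite -ler_pdivrMl //; apply/geS => u Cu.
  rewrite ler_pdivrMl //; have /= := qle (t *: x) _ (CZ _ _ t0 Cu).
  rewrite -scalerDr; have := ps.2 t (x + u.1) t0; lra.
- by move=> x; have := qle x _ C0; rewrite addr0 subr0.
- move=> u Cu; have := qle (- u.1) _ Cu; rewrite addNr (sublinear0 ps); lra.
Qed.

(** The pointwise infimum is the bound of a chain that Zorn's lemma asks for. It stays subadditive
    because, of two members used at [x] and at [y], the smaller one serves at both points. *)
Lemma sublinear_chain_inf p (A : set (X -> R)) : A !=set0 ->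
  (forall q, A q -> sublinear q /\ forall x, q x <= p x) ->
  total_on A (fun q1 q2 => `[< forall x, q2 x <= q1 x >]) ->
  exists q, [/\ sublinear q, forall x, q x <= p x &
    forall r, A r -> forall x, q x <= r x].
Proof.
move=> [r0 Ar0] As Atot.
pose S x := [set r x | r in A].
have Sn x : S x !=set0 by exists (r0 x); exists r0.
have Slb x : has_lbound (S x).
  exists (- p (- x)) => _ [r Ar <-]; have [rs rp] := As _ Ar.
  by have := sublinear_oppr x rs; have := rp (- x); lra.
have qle r x : A r -> inf (S x) <= r x.
  by move=> Ar; apply: ge_inf => //; exists r.
have geS x b : (forall r, A r -> b <= r x) -> b <= inf (S x).
  by move=> bS; apply: lb_le_inf => // _ [r Ar <-]; exact: bS.
exists (fun x => inf (S x)); split; first split.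
- move=> x y.
  suff : inf (S (x + y)) - inf (S y) <= inf (S x) by lra.
  apply/geS => r Ar.
  suff : inf (S (x + y)) - r x <= inf (S y) by lra.
  apply/geS => s As'; have [rs _] := As _ Ar; have [ss _] := As _ As'.
  have [/asboolP rles|/asboolP sler] := Atot _ _ Ar As'.
    have := qle _ (x + y) As'; have := ss.1 x y; have := rles x; lra.
  have := qle _ (x + y) Ar; have := rs.1 x y; have := sler y; lra.
- move=> t x t0; rewrite -ler_pdivrMl //; apply/geS => r Ar.
  rewrite ler_pdivrMl //; have := qle _ (t *: x) Ar.
  by have := (As _ Ar).1.2 t x t0; lra.
- by move=> x; have := qle _ x Ar0; have := (As _ Ar0).2 x; lra.
- by move=> r Ar x; exact: qle.
Qed.

(* A minimal sublinear function is linear: otherwise sublinear_cone, applied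
   to a ray, would lower it. *)
Lemma sublinear_ge_linear p : sublinear p ->
  exists2 f : X -> R, linear (f : X -> R^o) & forall x, f x <= p x.
Proof.
move=> ps.
pose T := {q : X -> R | sublinear q /\ forall x, q x <= p x}.
(* The order is reversed, so that a maximal element is a minimal function. *)
pose Rel (q r : T) := `[< forall x, sval r x <= sval q x >].
have t0 : T by exists p.
have [||A Atot|[q [qs qp]] qmin] := @ZL_preorder T t0 Rel.
- by move=> q; apply/asboolP.
- move=> r q s /asboolP qr /asboolP rs; apply/asboolP => x.
  by rewrite (le_trans (rs x)).
- have [[a Aa]|A0] := pselect (A !=set0); last first.
    by exists t0 => s As; exfalso; apply: A0; exists s.
  have [|||q [qs qp qA]] := @sublinear_chain_inf p [set sval r | r in A].
  + by exists (sval a); exists a.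
  + by move=> _ [r Ar <-]; exact: (svalP r).
  + by move=> _ _ [r Ar <-] [s As <-]; exact: (Atot _ _ Ar As).
  exists (exist _ q (conj qs qp)) => s As; apply/asboolP => x /=.
  by apply: qA; exists s.
exists q => //; apply: sublinear_odd_linear => // y.
(* On the ray through [(y, q y)] the cone lemma yields [r <= q] with [r (- y) <= - q y]; minimality
   gives [q <= r], hence [q (- y) <= - q y]. *)
pose C := [set u : X * R | exists2 t, 0 <= t & u = (t *: y, t * q y)].
have [|||u|r [rs rq rC]] := @sublinear_cone q C qs.
- by exists 0 => //; rewrite scale0r mul0r.
- move=> _ _ [t t_ge0 ->] [s s_ge0 ->]; exists (t + s).
    by rewrite addr_ge0.
  by rewrite scalerDl mulrDl.
- move=> t _ tgt0 [s s_ge0 ->]; exists (t * s).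
    by rewrite mulr_ge0 // ltW.
  by rewrite scalerA mulrA.
- case=> t; rewrite le_eqVlt => /orP[/eqP <- ->|tgt0 ->] /=.
    by rewrite scale0r mul0r (sublinear0 qs).
  rewrite -ler_pdivlMl //.
  have := qs.2 t^-1 (t *: y); rewrite invr_gt0 scalerA.
  rewrite mulVf ?scale1r ?gt_eqF //.
  exact.
have rT : sublinear r /\ forall x, r x <= p x.
  by split=> // x; rewrite (le_trans (rq x)).
have /asboolP/(_ (- y)) /= : Rel (exist _ r rT) (exist _ q (conj qs qp)).
  by apply: qmin; apply/asboolP.
move=> /le_trans; apply; have := rC (y, q y); apply.
by exists 1; rewrite ?scale1r ?mul1r.
Qed.

End sublinear.

(** * Continuous functionals: separation and weak convergence *)

Section dual.
Context {R : realType} {X : normedModType R}.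
Implicit Types (Z : set X) (e : X).

Lemma linear_subspaceP Z : linear_subspace Z <->
  Z 0 /\ forall (t : R) x y, Z x -> Z y -> Z (t *: x + y).
Proof.
split=> [[Z0 ZD]|[Z0 ZD]].
  split; first by move: Z0; rewrite inE.
  by move=> t x y Zx Zy; have := ZD t x y; rewrite !inE; apply.
split; first by rewrite inE.
by move=> t x y; rewrite !inE; exact: ZD.
Qed.

(** The one-sided bound, used at [x] and [- x], bounds the absolute value. *)
Lemma dual_of_bounded (f : X -> R) (M : R) : linear (f : X -> R^o) ->
  (forall x, f x <= M * `|x|) ->
  exists phi : dual X, forall x, sval phi x = f x.
Proof.
move=> lf fM.
pose F := GRing.isLinear.Build R X R^o *:%R f lf.
pose L : {linear X -> R^o} := HB.pack (f : X -> R^o) F.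
suff cL : continuous L by exists (exist _ L cL).
apply: bounded_linear_continuous; apply/linear_boundedP.
near=> r => x; rewrite (@le_trans _ _ (M * `|x|)) //.
  rewrite ler_norml fM andbT; have := fM (- x).
  by rewrite -[f]/(L : X -> R) linearN normrN lerNl.
by rewrite ler_wpM2r //; near: r; apply: nbhs_pinfty_ge; rewrite num_real.
Unshelve. all: by end_near. Qed.

(** The norm is lowered along the cone of all [z + t *: e] with [t >= 0], where it is at least
    [t * d] for a lower bound [d] of the distance from [e] to [Z]. A linear functional below the
    result is nonnegative on [Z], hence zero there, and at least [d] at [e]; it remains to divide by
    its value at [e]. *)
Lemma dual_separation Z e : linear_subspace Z -> closed Z -> ~ Z e ->
  exists phi : dual X, sval phi e = 1 /\ forall z, Z z -> sval phi z = 0.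
Proof.
move=> /linear_subspaceP[Z0 ZD] clZ Ze.
have ZZ t z : Z z -> Z (t *: z) by move=> Zz; rewrite -[_ *: _]addr0; exact: ZD.
have [d d0 dist] : exists2 d : R, 0 < d & forall z, Z z -> d <= `|e - z|.
  have /nbhs_ballP[d /= d0 dZ] : nbhs e (~` Z).
    by apply: open_nbhs_nbhs; split => //; exact: closed_openC.
  exists d => // z Zz; rewrite leNgt; apply/negP => ez.
  by apply: (dZ z) => //; rewrite -ball_normE.
pose C := [set u : X * R | exists z t,
  [/\ Z z, 0 <= t & u = (z + t *: e, t * d)]].
have norms : sublinear (fun x : X => `|x| : R).
  split=> [x y|t x t0]; first exact: ler_normD.
  by rewrite normrZ gtr0_norm.
have [|||_ [z [t [Zz + ->]]]|q [qs qp qC]] := @sublinear_cone _ _ _ C norms.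
- by exists 0, 0; rewrite scale0r addr0 mul0r.
- move=> _ _ [z [t [Zz t0 ->]]] [z' [t' [Zz' t0' ->]]].
  exists (z + z'), (t + t').
  split; [|exact: addr_ge0|by rewrite scalerDl mulrDl addrACA].
  by rewrite -[z]scale1r; exact: ZD.
- move=> s _ s0 [z [t [Zz t0 ->]]]; exists (s *: z), (s * t).
  split; [exact: ZZ|by rewrite mulr_ge0 // ltW|].
  by rewrite scalerDr scalerA mulrA.
- rewrite le_eqVlt => /orP[/eqP <-|t0] /=; first by rewrite mul0r.
  (* Factoring out [t] leaves the distance from [e] to a point of [Z]. *)
  have -> : z + t *: e = t *: (e - (- t^-1) *: z).
    rewrite scalerBr scaleNr scalerN scalerA divff ?gt_eqF // scale1r.
    by rewrite opprK addrC.
  by rewrite normrZ gtr0_norm // ler_pM2l //; apply/dist/ZZ.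
have [f lf fq] := sublinear_ge_linear qs.
have fp x : f x <= `|x| by rewrite (le_trans (fq x)).
have [phi phiE] : exists phi : dual X, forall x, sval phi x = f x.
  by apply: (@dual_of_bounded _ 1) => // x; rewrite mul1r.
have phiZ z : Z z -> sval phi z = 0.
  have phiZ_ge0 y : Z y -> 0 <= sval phi y.
    move=> Zy; rewrite -oppr_le0 -linearN phiE (le_trans (fq _)) //.
    have := qC (y, 0); rewrite oppr0; apply; exists y, 0.
    by rewrite scale0r addr0 mul0r.
  move=> Zz; apply/eqP; rewrite eq_le phiZ_ge0 // andbT -oppr_ge0 -linearN.
  by apply: phiZ_ge0; rewrite -scaleN1r; exact: ZZ.
have phie : 0 < sval phi e.
  rewrite (lt_le_trans d0) // -lerN2 -linearN phiE (le_trans (fq _)) //.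
  by have := qC (e, d); apply; exists 0, 1; rewrite add0r scale1r mul1r.
have [psi psiE] : exists psi : dual X,
    forall x, sval psi x = (sval phi e)^-1 * sval phi x.
  apply: (@dual_of_bounded _ (sval phi e)^-1) => [t x y|x].
    rewrite linearP mulrDr; congr (_ + _).
    by rewrite /GRing.scale /= mulrCA.
  by rewrite ler_pM2l ?invr_gt0 // phiE.
exists psi; split=> [|z Zz]; rewrite psiE; first by rewrite mulVf ?gt_eqF.
by rewrite (phiZ z) // mulr0.
Qed.

(** Convergence for a supremum of topologies is convergence for each of them, and each initial
    topology is tested by its single functional. *)
Lemma cvg_weak_topologyP (F : set_system X) (x : X) :
  Filter F ->
  F --> (x : Topological.Pack (weak_topology X)) <->
  forall phi : dual X, sval phi y @[y --> F] --> sval phi x.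
Proof.
move=> FF; split=> [Fx phi|Fphi].
  have /cvg_sup/(_ phi) {}Fx := Fx.
  move=> A Ax; apply: (Fx (sval phi @^-1` A)).
  exact: (@initial_continuous X R^o (sval phi) x A).
apply/(@cvg_sup X) => phi A [_ [[B oB <-] Bx] BA].
rewrite nbhs_filterE; apply: filterS BA _.
by apply: (Fphi phi); exact: open_nbhs_nbhs.
Qed.

End dual.

(** * Shears and linear combinations in the norm and weak topologies *)

Section norm_or_weak.
Context {R : realType} {X : normedModType R} (tau : Topological X).
Hypothesis tauE : tau = norm_topology X \/ tau = weak_topology X.
Let T := Topological.Pack tau.

(** In the weak case a functional [psi] turns the map into [psi y - phi y * psi e], a combination of
    weakly continuous scalar functions. *)
Lemma tau_shear_continuous (phi : dual X) (e : X) :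
  continuous ((fun x : X => x - sval phi x *: e) : T -> T).
Proof.
rewrite /T; case: tauE => -> x.
  apply: (@cvgB _ X); first exact: cvg_id.
  by apply: (@cvgZr_tmp _ X); exact: (svalP phi).
pose W : topologicalType := Topological.Pack (weak_topology X).
have cphi : forall psi : dual X, sval psi y @[y --> (x : W)] --> sval psi x.
  apply/(@cvg_weak_topologyP _ X (nbhs (x : W)) x (nbhs_filter (x : W))).
  exact: cvg_id.
apply/(@cvg_weak_topologyP _ X _ _ (fmap_filter _ (nbhs_filter (x : W)))).
move=> psi.
have psiB y : sval psi (y - sval phi y *: e) =
    sval psi y - sval phi y * sval psi e.
  by rewrite linearB linearZ.
have psiBf : sval psi \o (fun y => y - sval phi y *: e) =
    (fun y => sval psi y - sval phi y * sval psi e).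
  by apply/funext => y; exact: psiB.
change (sval psi \o (fun y => y - sval phi y *: e) @ nbhs (x : W) -->
  sval psi (x - sval phi x *: e)).
rewrite psiBf psiB; apply: cvgB; first exact: cphi.
by apply: cvgMr_tmp; exact: cphi.
Qed.

Lemma tau_cvg_line (a : nat -> R) (a0 : R) (z : nat -> X) (l e : X) :
  a @ \oo --> a0 -> z @ \oo --> (l : T) ->
  (fun n => a n *: e + z n) @ \oo --> (a0 *: e + l : T).
Proof.
rewrite /T; case: tauE => -> aa0 zl.
  by apply: (@cvgD _ X) => //; apply: (@cvgZr_tmp _ X).
apply/(@cvg_weak_topologyP _ X _ _ (fmap_filter _ _)) => psi.
have cpsi := (@cvg_weak_topologyP _ X _ l (fmap_filter z _)).1 zl psi.
have psif : sval psi \o (fun n => a n *: e + z n) =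
    (fun n => a n * sval psi e + sval psi (z n)).
  by apply/funext => n; exact: linearP.
change (sval psi \o (fun n => a n *: e + z n) @ \oo --> sval psi (a0 *: e + l)).
rewrite psif linearP; apply: cvgD; [exact: cvgMr_tmp|exact: cpsi].
Qed.

End norm_or_weak.

(** Bolzano-Weierstrass: a cluster point in the compact segment [[-K, K]] is the limit of a
    subsequence. *)
Lemma bounded_cvg_subsequence (R : realType) (a : nat -> R) (K : R) :
  (forall n, `|a n| <= K) ->
  exists (s : nat -> nat) (l : R),
    {homo s : m n / (m < n)%N} /\ a \o s @ \oo --> l.
Proof.
move=> aK; have [|l [_ /cluster_eventually_cvg[s sinc sl]]] :=
    @segment_compact R (- K) K (a @ \oo) _.
  by exists 0%N => // n _; rewrite /= in_itv /= -ler_norml.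
exists s, l; split=> //.
by move=> m n; have := leW_mono sinc m n; rewrite !ltEnat /= => ->.
Qed.

(** * Convex, monotone and coercive functions *)

Section Fcmc_lemmas.
Context {R : realType} {N : nat} (f : 'rV[R]_N -> R) (Ff : Fcmc f).

Lemma Fcmc_sublevel_bounded (M : R) :
  exists K, forall phi, orthant phi -> f phi <= M -> forall i, phi ord0 i <= K.
Proof.
(* The level [M + 1] makes the conclusion of coercivity contradict [f phi <= M]. *)
have [K KM] := Fcmc_coercive Ff (M + 1); exists K => phi phi0 fM i.
rewrite leNgt; apply/negP => Ki; suff /(KM _ phi0) : K <= `|phi| by lra.
rewrite (le_trans (ltW Ki)) // (le_trans (ler_norm _)) //.
rewrite [leRHS]/Num.norm /= mx_normrE.
by apply/bigmax_geP; right => /=; exists (ord0, i).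
Qed.

(* psi <= (1 - d) phi + d (phi + 1), so convexity yields a modulus of
   continuity that is uniform on bounded parts of the orthant. *)
Lemma Fcmc_le_shift (K d : R) (phi psi : 'rV[R]_N) :
  orthant phi -> orthant psi -> 0 <= d <= 1 -> (forall i, phi ord0 i <= K) ->
  (forall i, psi ord0 i <= phi ord0 i + d) ->
  f psi <= f phi + d * f (const_mx (`|K| + 1)).
Proof.
move=> phi0 psi0 /andP[d0 d1] phiK psiphi.
have K0 : orthant (const_mx (`|K| + 1) : 'rV[R]_N).
  by move=> i; rewrite mxE addr_ge0.
pose phi1 := phi + const_mx 1.
have phi10 : orthant phi1 by move=> i; rewrite !mxE addr_ge0.
have phid0 : orthant (d *: phi1 + (1 - d) *: phi).
  by move=> i; rewrite !mxE addr_ge0 ?mulr_ge0 ?subr_ge0 ?addr_ge0.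
have h1 : f psi <= f (d *: phi1 + (1 - d) *: phi).
  apply: (Fcmc_monotone Ff) => // i; rewrite !mxE.
  by have := psiphi i; lra.
have h2 : f (d *: phi1 + (1 - d) *: phi) <= d * f phi1 + (1 - d) * f phi.
  have := Fcmc_convex Ff (Itv01 d0 d1); apply; exact: mem_set.
have h3 : f phi1 <= f (const_mx (`|K| + 1)).
  apply: (Fcmc_monotone Ff) => // i; rewrite !mxE lerD2r.
  by rewrite (le_trans (phiK i)) // ler_norm.
(* Nonnegativity allows [(1 - d) * f phi] to be replaced by [f phi]. *)
have h4 := Fcmc_ge0 Ff phi0.
have : d * f phi1 <= d * f (const_mx (`|K| + 1)) by rewrite ler_wpM2l.
have : 0 <= d * f phi by rewrite mulr_ge0.
lra.
Qed.

End Fcmc_lemmas.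

(** * Restricted radii and minimizing sequences *)

Section rad_lemmas.
Context {R : realType} {X : normedModType R} {N : nat} (f : 'rV[R]_N -> R).
Hypothesis Ff : Fcmc f.

Lemma rad_le (V : set X) (x : 'I_N -> X) v : V v -> Defs.rad f V x <= rf f v x.
Proof.
move=> Vv; apply: ge_inf; last by exists v.
by exists 0 => _ [w _ <-]; apply: (Fcmc_ge0 Ff) => i; rewrite mxE.
Qed.

Lemma le_rad (V : set X) (x : 'I_N -> X) b : V !=set0 ->
  (forall v, V v -> b <= rf f v x) -> b <= Defs.rad f V x.
Proof.
move=> [v Vv] bV; apply: lb_le_inf; first by exists (rf f v x), v.
by move=> _ [w Vw <-]; exact: bV.
Qed.

End rad_lemmas.

Lemma cvg_subsequence (T : Type) (G : set_system T) (s : nat -> nat)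
    (u : nat -> T) : {homo s : m n / (m < n)%N} ->
  u n @[n --> \oo] --> G -> (u \o s) n @[n --> \oo] --> G.
Proof.
move=> s_incr uG; apply: cvg_comp uG => A [N _ NA]; exists N => // n /= Nn.
apply: NA => /=; apply: leq_trans Nn _.
(* A strictly increasing [s] satisfies [n <= s n]. *)
by elim: n => // n IH; rewrite (leq_ltn_trans IH) // s_incr.
Qed.

Section rf_sequences.
Context {R : realType} {X : normedModType R} {N : nat} (f : 'rV[R]_N -> R).
Hypothesis Ff : Fcmc f.
Variables (x : 'I_N -> X) (w : nat -> X) (r : R).
Hypothesis wr : rf f (w n) x @[n --> \oo] --> r.

Let orthant_dist (v : X) : orthant (\row_i `|v - x i|).
Proof. by move=> i; rewrite mxE. Qed.

(** Convergent values are bounded, and coercivity bounds sublevel sets. *)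
Lemma rf_cvg_bounded : exists K, forall n i, `|w n - x i| <= K.
Proof.
have [M [_ /(_ (M + 1))]] : bounded_fun (fun n => rf f (w n) x).
  by apply: cvg_seq_bounded; apply/cvg_ex; exists r.
rewrite ltrDl ltr01 => /(_ isT) wM.
have [K KM] := Fcmc_sublevel_bounded Ff (M + 1).
exists K => n i; have := KM _ (orthant_dist (w n)) _ i; rewrite mxE; apply.
by rewrite (le_trans (ler_norm _)) //; exact: wM.
Qed.

(** The values at [u n] are squeezed between [r] and the bound of [Fcmc_le_shift] for the shift
    [d = |w n - u n|], which is eventually at most 1. *)
Lemma rf_cvg_perturb (u : nat -> X) :
  `|w n - u n| @[n --> \oo] --> 0 -> (forall n, r <= rf f (u n) x) ->
  rf f (u n) x @[n --> \oo] --> r.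
Proof.
move=> wu ru; have [K wK] := rf_cvg_bounded.
pose c := f (const_mx (`|K| + 1)).
apply: (@squeeze_cvgr _ _ _ _ (fun=> r)
  (fun n => rf f (w n) x + `|w n - u n| * c)).
- near=> n; rewrite ru /=; apply: Fcmc_le_shift => //.
  + by rewrite normr_ge0 /=; near: n; exact: (cvgr_le _ wu _ ltr01).
  + by move=> i; rewrite mxE.
  + move=> i; rewrite !mxE (distrC (w n) (u n)) [leRHS]addrC.
    have -> : u n - x i = (u n - w n) + (w n - x i) by rewrite addrA subrK.
    exact: ler_normD.
- exact: cvg_cst.
- rewrite -[X in _ --> X]addr0 -[X in _ + X](mul0r c).
  by apply: cvgD => //; exact: cvgMr_tmp.
Unshelve. all: by end_near. Qed.

End rf_sequences.

(** * Adjoining a line to a subspace *)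

Section add_line.
Context {R : realType} {X : normedModType R}.
Implicit Types (Z : set X) (e : X).

Definition add_line e Z : set X := set_add (range (fun t : R => t *: e)) Z.

Lemma add_lineP e Z w : add_line e Z w <-> exists t z, Z z /\ w = t *: e + z.
Proof.
split=> [[_ [t _ <-] [z Zz <-]]|[t [z [Zz ->]]]]; first by exists t, z.
by exists (t *: e); [exists t|exists z].
Qed.

Lemma linear_subspace_add_line e Z :
  linear_subspace Z -> linear_subspace (add_line e Z).
Proof.
move=> /linear_subspaceP[Z0 ZD]; apply/linear_subspaceP; split.
  by apply/add_lineP; exists 0, 0; rewrite scale0r addr0.
move=> t _ _ /add_lineP[a [y [Zy ->]]] /add_lineP[b [z [Zz ->]]].
apply/add_lineP; exists (t * a + b), (t *: y + z); split; first exact: ZD.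
by rewrite scalerDr scalerDl scalerA addrACA.
Qed.

Lemma add_line_id e Z : linear_subspace Z -> Z e -> add_line e Z = Z.
Proof.
move=> /linear_subspaceP[Z0 ZD] Ze; apply/seteqP; split=> [w|w Zw].
  by move=> /add_lineP[t [z [Zz ->]]]; exact: ZD.
by apply/add_lineP; exists 0, w; rewrite scale0r add0r.
Qed.

(** [phi] reads off the coefficient of [e], so subtracting [phi w *: e] leaves the component in
    [Z]. *)
Lemma add_line_preimage e Z (phi : dual X) : sval phi e = 1 ->
  (forall z, Z z -> sval phi z = 0) ->
  add_line e Z = (fun y => y - sval phi y *: e) @^-1` Z.
Proof.
move=> phie phiZ; apply/seteqP; split=> [w|w Zw] /=.
  move=> /add_lineP[t [z [Zz ->]]].
  rewrite linearP (phiZ z) // phie.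
  have -> : t *: (1 : R^o) + (0 : R^o) = t by rewrite addr0; exact: mulr1.
  by rewrite addrAC subrr add0r.
apply/add_lineP; exists (sval phi w), (w - sval phi w *: e).
by rewrite [RHS]addrC subrK.
Qed.

Section topology.
Variable tau : Topological X.
Hypothesis tauE : tau = norm_topology X \/ tau = weak_topology X.
Let T := Topological.Pack tau.

(** Norm closedness of [Z] gives the separating functional; [tau]-closedness is what the shear pulls
    back. *)
Lemma tau_closed_add_line e Z : linear_subspace Z -> closed Z ->
  tau_closed tau Z -> tau_closed tau (add_line e Z).
Proof.
move=> subZ clZ tclZ; have [Ze|/(dual_separation subZ clZ)] := pselect (Z e).
  by rewrite add_line_id.
move=> [phi [phie phiZ]]; rewrite (add_line_preimage phie phiZ).
apply: (@preimage_closed T T _ _ _ tclZ) => y _.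
exact: (tau_shear_continuous tauE).
Qed.

Lemma Fcmc_SACP_add_line e Z : linear_subspace Z -> closed Z ->
  Fcmc_SACP tau Z -> Fcmc_SACP tau (add_line e Z).
Proof.
move=> subZ clZ sacpZ; have [Ze|] := pselect (Z e).
  by rewrite add_line_id.
move=> /(dual_separation subZ clZ)[phi [phie phiZ]].
split; first exact: tau_closed_add_line sacpZ.1.
move=> F [_ [y0 Fy0]] N x xF f Ff w Lw wr.
(* An index exists because [F] is nonempty; [x i0] anchors the bound on [w n] below. *)
have [i0 _ _] : [set x i | i in [set: 'I_N]] y0 by apply: (set_bij_surj xF).
set r := Defs.rad f (add_line e Z) x in wr *.
pose a n := sval phi (w n); pose z n := w n - a n *: e.
have wE n : w n = a n *: e + z n by rewrite /z [RHS]addrC subrK.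
have Zz n : Z (z n) by have := Lw n; rewrite (add_line_preimage phie phiZ).
have [K aK] : exists K, forall n, `|a n| <= K.
  have [K wK] := rf_cvg_bounded Ff wr.
  have [M [_ /(_ (`|M| + 1))]] := (linear_boundedP (sval phi)).1
     ((linear_bounded_continuous (sval phi)).2 (svalP phi)).
  (* The constant [|M| + 1] is both above [M] and positive. *)
  rewrite ltr_pwDr ?ler_norm // => /(_ isT) phiM.
  exists ((`|M| + 1) * (K + `|x i0|)) => n; rewrite (le_trans (phiM _)) //.
  rewrite ler_pM2l ?ltr_wpDl //.
  have := ler_normD (w n - x i0) (x i0); rewrite subrK => /le_trans; apply.
  by rewrite lerD2r.
have [s [a0 [s_incr asa0]]] := bounded_cvg_subsequence aK.
(* Only the coefficient is replaced by its limit, so [w (s n) - u n] is [(a (s n) - a0) *: e] and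
   tends to 0. *)
pose u n := a0 *: e + z (s n).
have uL n : add_line e Z (u n) by apply/add_lineP; exists a0, (z (s n)).
have ur : rf f (u n) x @[n --> \oo] --> r.
  apply: (@rf_cvg_perturb _ _ _ _ Ff x (w \o s)).
  - exact: (@cvg_subsequence _ (nbhs r) s (fun n => rf f (w n) x)).
  - have -> : (fun n => `|(w \o s) n - u n|) =
        (fun n => `|(a \o s) n - a0| * `|e|).
      apply/funext => n; rewrite /u /= [w _]wE opprD addrACA subrr addr0.
      by rewrite -scalerBl normrZ.
    rewrite -(mul0r `|e|); apply: cvgMr_tmp.
    rewrite -(@normr0 _ R) -(subrr a0); apply: cvg_norm.
    by apply: cvgB => //; exact: cvg_cst.
  - by move=> n; exact: rad_le.
(* Translating the centers absorbs [a0 *: e] and leaves a sequence in [Z]. *)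
pose x' i := x i - a0 *: e.
have rfx' v : rf f v x' = rf f (a0 *: e + v) x.
  by congr f; apply/rowP => i; rewrite !mxE /x' opprB addrA [v + _]addrC.
have x'F : set_bij [set: 'I_N] (range x') x'.
  split=> [i _|i j _ _ /addIr xij|_ [i _ <-]]; [by exists i| |by exists i].
  by apply: (set_bij_inj xF) xij; exact: in_setT.
(* The values at [u n] tend to [r] and are at least the radius over [Z]; conversely, [a0 *: e + Z]
   lies in [add_line e Z]. *)
have radE : Defs.rad f Z x' = r.
  apply/eqP; rewrite eq_le; apply/andP; split.
    apply: cvgr_to_ge ur _.
    by apply: nearW => n; rewrite -rfx'; exact: rad_le.
  apply: le_rad; first by exists (z 0%N).
  move=> v Zv; rewrite rfx'; apply: rad_le => //.
  by apply/add_lineP; exists a0, v.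
have finF : nonempty_finite (range x').
  by split; [exact: finite_image|exists (x' i0), i0].
have zr : rf f (z (s n)) x' @[n --> \oo] --> Defs.rad f Z x'.
  by under eq_fun do rewrite rfx'; rewrite radE.
have [s' s'_incr [l zl]] :=
  sacpZ.2 _ finF N x' x'F f Ff (z \o s) (fun n => Zz (s n)) zr.
exists (s \o s'); first by move=> m n mn; exact/s_incr/s'_incr.
exists (a0 *: e + l).
rewrite (_ : w \o (s \o s') =
  fun n => (a \o s \o s') n *: e + (z \o s \o s') n); last first.
  by apply/funext => n; exact: wE.
apply: (@tau_cvg_line _ _ tau tauE (a \o s \o s') a0 (z \o s \o s') l e _ zl).
exact: (@cvg_subsequence _ (nbhs a0) s' (a \o s)).
Qed.

End topology.

End add_line.

(** The line through the first generator moves from the span to [Z], which is why the induction on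
    the number of generators lets [Z] vary. *)
Lemma set_add_spanS (R : realType) (X : normedModType R) (n : nat)
    (e : 'I_n.+1 -> X) (Z : set X) :
  set_add [set \sum_(i < n.+1) a i *: e i | a in [set: 'I_n.+1 -> R]] Z =
  set_add [set \sum_(i < n) a i *: e (lift ord0 i) | a in [set: 'I_n -> R]]
    (add_line (e ord0) Z).
Proof.
apply/seteqP; split=> _ [_ [a _ <-] [z Zz <-]].
  exists (\sum_(i < n) a (lift ord0 i) *: e (lift ord0 i)).
    by exists (fun i => a (lift ord0 i)).
  exists (a ord0 *: e ord0 + z); first by apply/add_lineP; exists (a ord0), z.
  by rewrite big_ord_recl addrCA addrA.
have [t [y [Zy ->]]] := (add_lineP _ _ _).1 Zz.
(* [b] is [a] with [t] prepended at index 0. *)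
pose b i := if unlift ord0 i is Some j then a j else t.
exists (\sum_(i < n.+1) b i *: e i); first by exists b.
exists y => //; rewrite big_ord_recl /b unlift_none.
under eq_bigr do rewrite liftK.
by rewrite -addrA addrCA.
Qed.

Theorem theorem3p10 (R : realType) (X : completeNormedModType R)
    (tau : Topological X)
    (tauE : tau = norm_topology X \/ tau = weak_topology X)
    (Y Z : set X)
    (finY : finite_dim_subspace Y)
    (linZ : linear_subspace Z) (closedZ : closed Z)
    (sacpZ : Fcmc_SACP tau Z) :
  Fcmc_SACP tau (set_add Y Z).
Proof.
case: finY => n [e ->]; elim: n e Z linZ closedZ sacpZ =>
    [|n IH] e Z linZ clZ sacpZ.
  rewrite (_ : set_add _ _ = Z) //.
  apply/seteqP; split=> [_ [_ [a _ <-] [z Zz <-]]|z Zz].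
    by rewrite big_ord0 add0r.
  exists 0; last by exists z => //; rewrite add0r.
  by exists (fun=> 0) => //; rewrite big_ord0.
rewrite set_add_spanS; apply: IH.
- exact: linear_subspace_add_line.
(* The induction needs norm closedness whichever topology [tau] is, so the lemma is applied to the
   norm topology. *)
- exact: (tau_closed_add_line (or_introl erefl)).
- exact: Fcmc_SACP_add_line.
Qed.
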